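(* Let $\mathrm{K}$ be a field and let $A\in\mathrm{K}^{m\times n}$ be a matrix of rank $r$. Then there exists a unique $m\times n$ $r$-sub-permutation matrix $\mathcal{R}_A$ such that every leading sub-matrix of $\mathcal{R}_A$ has the same rank as the corresponding leading sub-matrix of $A$; that is, $\operatorname{rank}((\mathcal{R}_A)_{1..i,1..j})=\operatorname{rank}(A_{1..i,1..j})$ for all $1\le i\le m$ and $1\le j\le n$.
   Context: An $r$-sub-permutation matrix is a matrix of rank $r$ with only $r$ nonzero entries, all equal to one (hence at most one nonzero entry per row and per column). $M_{1..i,1..j}$ denotes the leading sub-matrix formed by the first $i$ rows and the first $j$ columns of $M$. The matrix $\mathcal{R}_A$ is called the rank profile matrix of $A$. *)

(* Defs.v *)
From mathcomp Require Import all_boot all_order all_algebra.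

Set Implicit Arguments.
Unset Strict Implicit.
Unset Printing Implicit Defensive.

Import GRing.Theory.
Local Open Scope ring_scope.

Definition leading_submx (K : fieldType) (m n i j : nat)
    (le_im : (i <= m)%N) (le_jn : (j <= n)%N) (M : 'M[K]_(m, n)) : 'M[K]_(i, j) :=
  mxsub (widen_ord le_im) (widen_ord le_jn) M.

(* That each row and each column has at most one nonzero entry is a consequence
   of these three conditions, not an extra requirement. *)
Definition sub_permutation_mx (K : fieldType) (m n r : nat)
    (P : 'M[K]_(m, n)) : Prop :=
  [/\ \rank P = r,
      #|[set p : 'I_m * 'I_n | P p.1 p.2 != 0]| = r
    & forall i j, P i j != 0 -> P i j = 1].

(* Main.v *)
Require Import Defs.
From mathcomp Require Import all_boot all_order all_algebra.
From mathcomp Require Import zify.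

(* Let rho(i,j) be the rank of the leading i x j sub-matrix of A. Its mixed second
   differences are nonnegative by Frobenius' rank inequality, and its first
   differences lie in {0,1}; hence the mixed second differences form a 0/1 matrix
   with at most one 1 per row and per column. Summing them back gives rho(i,j) ones
   in each leading block. Conversely, in a matrix whose rank equals its number
   of nonzero entries, every leading block has this property too, so the ranks of
   the leading blocks determine where the nonzero entries are. *)

Set Implicit Arguments.
Unset Strict Implicit.
Unset Printing Implicit Defensive.

Import GRing.Theory.
Local Open Scope ring_scope.

Lemma sum_le1_inj p (b : 'I_p -> bool) x y :
  (\sum_x b x <= 1)%N -> b x -> b y -> x = y.
Proof.
move=> sum1 bx bY; apply/eqP; apply: contraLR sum1 => nxy.
by rewrite (bigD1 x) //= (bigD1 y) 1?eq_sym //= bx bY.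
Qed.

Section RankProfile.

Variable K : fieldType.

(** * Sub-matrices, partial identities and zero-padded leading blocks *)

Lemma mxrank_mxsub (m n p q : nat) (f : 'I_p -> 'I_m) (g : 'I_q -> 'I_n)
    (M : 'M[K]_(m, n)) : (\rank (mxsub f g M) <= \rank M)%N.
Proof.
have rowsub_le a b c (h : 'I_a -> 'I_b) (N : 'M[K]_(b, c)) :
    (\rank (rowsub h N) <= \rank N)%N.
  by rewrite -[N in rowsub h N]mul1mx -mul_rowsub_mx mxrankM_maxr.
have -> : mxsub f g M = rowsub f (rowsub g M^T)^T.
  by apply/matrixP=> k l; rewrite !mxE.
apply: leq_trans (rowsub_le _ _ _ _ _) _; rewrite mxrank_tr.
by apply: leq_trans (rowsub_le _ _ _ _ _) _; rewrite mxrank_tr.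
Qed.

Lemma mul_pid_mxE (p m n s : nat) (M : 'M[K]_(m, n)) (k : 'I_p) (x : 'I_m) l :
  k = x :> nat -> ((pid_mx s : 'M_(p, m)) *m M) k l = (k < s)%:R * M x l.
Proof.
move=> kx; rewrite mxE (bigD1 x) //= big1 ?addr0 => [|y yx].
  by rewrite !mxE kx eqxx.
by rewrite !mxE kx eq_sym (inj_eq val_inj) (negPf yx) mul0r.
Qed.

Lemma mul_mx_pidE (p m n s : nat) (M : 'M[K]_(m, n)) k (l : 'I_p) (y : 'I_n) :
  l = y :> nat -> (M *m (pid_mx s : 'M_(n, p))) k l = M k y * (l < s)%:R.
Proof.
move=> ly; rewrite mxE (bigD1 y) //= big1 ?addr0 => [|x xy].
  by rewrite !mxE ly eqxx.
by rewrite !mxE ly (inj_eq val_inj) (negPf xy) mulr0.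
Qed.

(** The difference is the elementary matrix at [(i, i)] when [i < p], and zero otherwise. *)
Lemma mxrank_pid_step p i : (\rank (pid_mx i.+1 - pid_mx i : 'M[K]_p)%R <= 1)%N.
Proof.
have [lt_ip | le_pi] := ltnP i p.
  pose x := Ordinal lt_ip.
  have <- : delta_mx x x = pid_mx i.+1 - pid_mx i :> 'M[K]_p.
    apply/matrixP=> k l; rewrite !mxE -!val_eqE /= ltnS.
    have [<-|] := eqVneq (val k) (val l); last first.
      by move=> nkl; case: eqP => [ki|_]; rewrite subrr // -ki eq_sym (negPf nkl).
    by case: ltngtP => _; rewrite ?subrr ?subr0.
  by rewrite mxrank_delta.
rewrite (_ : _ - _ = 0) ?mxrank0 //.
apply/matrixP=> k l; rewrite !mxE.
by rewrite (leq_trans (ltn_ord k) le_pi) ltnS ltnW ?subrr // (leq_trans _ le_pi).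
Qed.

(** The leading block padded with zeros to full size: all blocks then share one type, [i] and [j]
    need no bounds, and rank inequalities for products apply directly. *)
Definition corner (m n i j : nat) (M : 'M[K]_(m, n)) : 'M[K]_(m, n) :=
  pid_mx i *m M *m pid_mx j.

Lemma cornerE (m n i j : nat) (M : 'M[K]_(m, n)) k l :
  corner i j M k l = M k l *+ ((k < i) && (l < j))%N.
Proof.
rewrite (mul_mx_pidE _ _ _ (erefl (val l))) (mul_pid_mxE _ _ _ (erefl (val k))).
by case: (k < i)%N; case: (l < j)%N; rewrite ?mul1r ?mul0r ?mulr1 ?mulr0.
Qed.

Lemma corner_full (m n : nat) (M : 'M[K]_(m, n)) : corner m n M = M.
Proof. by rewrite /corner !pid_mx_1 mul1mx mulmx1. Qed.

Lemma leading_submxE (m n i j : nat) (le_im : (i <= m)%N) (le_jn : (j <= n)%N)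
    (M : 'M[K]_(m, n)) :
  leading_submx le_im le_jn M = pid_mx i *m M *m pid_mx j.
Proof.
apply/matrixP=> k l; rewrite mxE.
rewrite (@mul_mx_pidE _ _ _ _ _ _ _ (widen_ord le_jn l)) //.
rewrite (@mul_pid_mxE _ _ _ _ _ _ (widen_ord le_im k)) //.
by rewrite !ltn_ord mul1r mulr1.
Qed.

(** Each matrix is obtained from the other by an operation that cannot raise the rank: selecting a
    sub-matrix one way, multiplying by partial identities the other way. *)
Lemma mxrank_leading (m n i j : nat) (le_im : (i <= m)%N) (le_jn : (j <= n)%N)
    (M : 'M[K]_(m, n)) : \rank (leading_submx le_im le_jn M) = \rank (corner i j M).
Proof.
apply/eqP; rewrite eqn_leq; apply/andP; split.
  have -> : leading_submx le_im le_jn M = leading_submx le_im le_jn (corner i j M).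
    by apply/matrixP=> k l; rewrite [LHS]mxE [RHS]mxE cornerE /= !ltn_ord.
  exact: mxrank_mxsub.
have -> : corner i j M
    = pid_mx i *m leading_submx le_im le_jn M *m (pid_mx j : 'M_(j, n)).
  rewrite leading_submxE !mulmxA mul_pid_mx -!mulmxA mul_pid_mx !minnn.
  by rewrite !mulmxA.
by apply: leq_trans (mxrankM_maxl _ _) (mxrankM_maxr _ _).
Qed.

(** * Rank against the number of nonzero entries *)

Definition supp (m n : nat) (M : 'M[K]_(m, n)) : {set 'I_m * 'I_n} :=
  [set p | M p.1 p.2 != 0].

(** [M] is a sum of [#|supp M|] multiples of elementary matrices, each of rank at most one. *)
Lemma mxrank_leq_supp (m n : nat) (M : 'M[K]_(m, n)) :
  (\rank M <= #|supp M|)%N.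
Proof.
have {1}-> : M = \sum_(p in supp M) M p.1 p.2 *: delta_mx p.1 p.2.
  rewrite {1}[M]matrix_sum_delta pair_bigA /= [LHS](bigID [in supp M]) /=.
  rewrite [X in _ + X]big1 ?addr0 // => p.
  by rewrite inE negbK => /eqP ->; rewrite scale0r.
rewrite -sum1_card.
apply: (big_ind2 (fun (B : 'M[K]_(m, n)) c => \rank B <= c)%N).
- by rewrite mxrank0.
- move=> B1 c1 B2 c2 h1 h2.
  exact: leq_trans (mxrank_add _ _) (leq_add h1 h2).
- move=> p _; apply: leq_trans (mxrank_scale _ _) _.
  by rewrite mxrank_delta.
Qed.

Lemma card_supp_corner (m n i j : nat) (M : 'M[K]_(m, n)) :
  #|supp (corner i j M)| =
  (\sum_(k < m | k < i) \sum_(l < n | l < j) (M k l != 0)%R)%N.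
Proof.
rewrite -sum1_card (pair_big _ _ (fun k l => nat_of_bool (M k l != 0))) /=.
rewrite big_mkcond [RHS]big_mkcond /=; apply: eq_bigr => p _.
by rewrite inE cornerE; case: ifP => //=; case: (_ && _); rewrite ?eqxx //= => ->.
Qed.

(* The rank is at most the number of nonzero entries, and the latter is additive
   over [M = C + (M - C)], so equality for [M] forces equality for [C]. *)
Lemma mxrank_corner_full_supp (m n i j : nat) (M : 'M[K]_(m, n)) :
  \rank M = #|supp M| -> \rank (corner i j M) = #|supp (corner i j M)|.
Proof.
move=> rkM; apply/eqP; rewrite eqn_leq mxrank_leq_supp /=.
set C := corner i j M.
have MC k l : (M - C) k l = if C k l == 0 then M k l else 0.
  rewrite mxE [X in _ + X]mxE [in RHS]/C /C cornerE.
  case: (_ && _); rewrite ?mulr1n ?mulr0n ?eqxx ?subr0 //.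
  by rewrite subrr; case: eqP.
have disj : (#|supp C| + #|supp (M - C)| = #|supp M|)%N.
  rewrite -(cardsID (supp C) (supp M)); congr (_ + _)%N.
    apply: eq_card => p; rewrite !inE /C cornerE; case: (_ && _) => //=.
      by rewrite andbb.
    by rewrite eqxx andbF.
  apply: eq_card => p; rewrite !inE MC; case: (C _ _ == 0) => //=.
  by rewrite eqxx.
rewrite -(leq_add2r #|supp (M - C)|) disj -rkM.
rewrite -[M in (\rank M <= _)%N](subrK C) addrC.
apply: leq_trans (mxrank_add _ _) _.
by rewrite leq_add2l mxrank_leq_supp.
Qed.

Lemma mxrank_partial_perm (m n : nat) (P : 'M[K]_(m, n)) :
    (forall k l, P k l != 0 -> P k l = 1) ->
    (forall k l l', P k l != 0 -> P k l' != 0 -> l = l') ->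
    (forall k k' l, P k l != 0 -> P k' l != 0 -> k = k') ->
  \rank P = #|supp P|.
Proof.
move=> P1 Prow Pcol; apply/eqP; rewrite eqn_leq mxrank_leq_supp /=.
pose e (x : 'I_#|supp P|) := enum_val x.
have eP x : P (e x).1 (e x).2 != 0 by have := enum_valP x; rewrite inE.
(* Taking the row and the column of each support element, in enumeration order, selects an identity
   matrix of size [#|supp P|]. *)
have <- : \rank (mxsub (fun x => (e x).1) (fun x => (e x).2) P) = #|supp P|.
  rewrite -[RHS](mxrank1 K); congr (\rank _); apply/matrixP=> x y; rewrite !mxE.
  have [<-|nxy] := eqVneq x y; first exact: P1.
  apply/eqP; apply: contraNT nxy => Pxy; apply/eqP/enum_val_inj.
  rewrite -/(e x) -/(e y) [e x]surjective_pairing [e y]surjective_pairing.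
  by rewrite (Prow _ _ _ (eP x) Pxy) (Pcol _ _ _ Pxy (eP y)).
exact: mxrank_mxsub.
Qed.

(** * Leading ranks and their mixed second differences *)

Section CornerRank.

Variables (m n : nat) (A : 'M[K]_(m, n)).

Definition rho i j := \rank (corner i j A).

Lemma rho0n j : rho 0 j = 0%N.
Proof. by rewrite /rho /corner pid_mx_0 !mul0mx mxrank0. Qed.

Lemma rhon0 i : rho i 0 = 0%N.
Proof. by rewrite /rho /corner pid_mx_0 mulmx0 mxrank0. Qed.

Lemma rho_full : rho m n = \rank A.
Proof. by rewrite /rho corner_full. Qed.

Lemma corner_corner i i' j j' : (i <= i')%N -> (j <= j')%N ->
  pid_mx i *m corner i' j' A *m pid_mx j = corner i j A.
Proof.
move=> le_i le_j; apply/matrixP=> k l.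
rewrite -/(corner i j (corner i' j' A)) !cornerE.
have [ki|] := ltnP k i; have [lj|] := ltnP l j => //=.
by rewrite (leq_trans ki le_i) (leq_trans lj le_j).
Qed.

(* Frobenius' rank inequality for [pid_mx i *m B *m pid_mx j], where [B] is the
   corner of size [(i.+1, j.+1)]. *)
Lemma rho_supermodular i j :
  (rho i j.+1 + rho i.+1 j <= rho i.+1 j.+1 + rho i j)%N.
Proof.
have := mxrank_Frobenius (pid_mx i : 'M_m) (corner i.+1 j.+1 A) (pid_mx j : 'M_n).
rewrite corner_corner //.
have -> : pid_mx i *m corner i.+1 j.+1 A = corner i j.+1 A.
  apply/matrixP=> k l; rewrite (mul_pid_mxE _ _ _ (erefl (val k))) !cornerE ltnS.
  by case: ltngtP; rewrite ?mul0r ?mul1r.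
have -> // : corner i.+1 j.+1 A *m pid_mx j = corner i.+1 j A.
apply/matrixP=> k l; rewrite (mul_mx_pidE _ _ _ (erefl (val l))) !cornerE.
by rewrite [(l < j.+1)%N]ltnS; case: (ltngtP l j); rewrite ?mulr0 ?mulr1 ?andbF.
Qed.

Lemma rho_leS i j : (rho i j <= rho i.+1 j)%N.
Proof.
rewrite /rho -(corner_corner (leqnSn i) (leqnn j)).
exact: leq_trans (mxrankM_maxl _ _) (mxrankM_maxr _ _).
Qed.

Lemma rho_leSr i j : (rho i j <= rho i j.+1)%N.
Proof.
rewrite /rho -(corner_corner (leqnn i) (leqnSn j)).
exact: leq_trans (mxrankM_maxl _ _) (mxrankM_maxr _ _).
Qed.

(** The larger corner differs from the smaller one by a single row, a matrix of rank at most one. *)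
Lemma rho_Sle i j : (rho i.+1 j <= (rho i j).+1)%N.
Proof.
have -> : rho i.+1 j =
    \rank (corner i j A + (pid_mx i.+1 - pid_mx i : 'M_m) *m A *m (pid_mx j : 'M_n))%R.
  by rewrite /rho /corner -mulmxDl -mulmxDl addrC subrK.
apply: leq_trans (mxrank_add _ _) _; rewrite -[leqRHS]addn1 leq_add2l.
apply: leq_trans (mxrankM_maxl _ _) _; apply: leq_trans (mxrankM_maxl _ _) _.
exact: mxrank_pid_step.
Qed.

Lemma rho_Srle i j : (rho i j.+1 <= (rho i j).+1)%N.
Proof.
have -> : rho i j.+1 =
    \rank (corner i j A + (pid_mx i : 'M_m) *m A *m (pid_mx j.+1 - pid_mx j : 'M_n))%R.
  by rewrite /rho /corner -mulmxDr addrC subrK.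
apply: leq_trans (mxrank_add _ _) _; rewrite -[leqRHS]addn1 leq_add2l.
apply: leq_trans (mxrankM_maxr _ _) _.
exact: mxrank_pid_step.
Qed.

(** The mixed second difference of [rho], stored as a boolean since it is always 0 or 1, and stated
    without truncated subtraction. *)
Definition rho_jump k l : bool :=
  (rho k.+1 l.+1 + rho k l != rho k l.+1 + rho k.+1 l)%N.

(** Supermodularity makes the second difference at least 0. It is at most 1 because column [l.+1]
    gains at most 1 from row [k] and column [l] loses nothing. *)
Lemma rho_jumpE k l :
  (rho k.+1 l.+1 + rho k l = rho k l.+1 + rho k.+1 l + rho_jump k l)%N.
Proof.
rewrite /rho_jump; have := rho_supermodular k l.
have := rho_Sle k l.+1; have := rho_leS k l; case: eqP => /=; lia.
Qed.

(** The sum telescopes along the row, starting from corners of width 0, whose rank is 0. *)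
Lemma sum_row_rho_jump k j :
  (rho k j + \sum_(l < j) rho_jump k l = rho k.+1 j)%N.
Proof.
elim: j => [|j /= IH]; first by rewrite big_ord0 !rhon0.
rewrite big_ord_recr /=; have := rho_jumpE k j; lia.
Qed.

Lemma sum_col_rho_jump l i :
  (rho i l + \sum_(k < i) rho_jump k l = rho i l.+1)%N.
Proof.
elim: i => [|i /= IH]; first by rewrite big_ord0 !rho0n.
rewrite big_ord_recr /=; have := rho_jumpE i l; lia.
Qed.

Lemma sum_rho_jump i j : (\sum_(k < i) \sum_(l < j) rho_jump k l = rho i j)%N.
Proof.
elim: i => [|i /= IH]; first by rewrite big_ord0 rho0n.
by rewrite big_ord_recr IH /= sum_row_rho_jump.
Qed.

Definition rank_profile : 'M[K]_(m, n) := \matrix_(k, l) (rho_jump k l)%:R.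

Lemma rank_profile_neq0 k l : (rank_profile k l != 0) = rho_jump k l.
Proof. by rewrite mxE; case: rho_jump; rewrite ?oner_neq0 ?eqxx. Qed.

Lemma card_supp_rank_profile i j : (i <= m)%N -> (j <= n)%N ->
  #|supp (corner i j rank_profile)| = rho i j.
Proof.
move=> le_im le_jn; rewrite card_supp_corner -sum_rho_jump.
rewrite (big_ord_widen _ (fun k => \sum_(l < j) rho_jump k l)%N le_im).
apply: eq_bigr => k _.
rewrite (big_ord_widen _ (fun l => rho_jump k l : nat) le_jn).
by apply: eq_bigr => l _; rewrite rank_profile_neq0.
Qed.

Lemma mxrank_rank_profile : \rank rank_profile = #|supp rank_profile|.
Proof.
apply: mxrank_partial_perm => [k l|k l l'|k k' l]; rewrite !rank_profile_neq0.
- by rewrite mxE => ->.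
- apply: (@sum_le1_inj _ (fun l => rho_jump k (val l))).
  (* The jumps in row [k] add up to [rho k.+1 n - rho k n], which is at most 1. *)
  by rewrite -(leq_add2l (rho k n)) sum_row_rho_jump addn1 rho_Sle.
- apply: (@sum_le1_inj _ (fun k => rho_jump (val k) l)).
  by rewrite -(leq_add2l (rho m l)) sum_col_rho_jump addn1 rho_Srle.
Qed.

End CornerRank.

(** Inclusion-exclusion on the four corners isolates the cell [(k, l)]. The shape matches
    [rho_jumpE], so that the two can be compared term by term. *)
Lemma supp_count_jump (m n : nat) (P : 'M[K]_(m, n)) (k : 'I_m) (l : 'I_n) :
  (#|supp (corner k.+1 l.+1 P)| + #|supp (corner k l P)| =
   #|supp (corner k l.+1 P)| + #|supp (corner k.+1 l P)| + (P k l != 0)%R)%N.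
Proof.
have step p (x : 'I_p) (F : 'I_p -> nat) :
    (\sum_(y < p | y < x.+1) F y = F x + \sum_(y < p | y < x) F y)%N.
  rewrite (bigD1 x) //=; congr addn; apply: eq_bigl => y.
  by rewrite -val_eqE /= ltnS ltn_neqAle andbC.
by rewrite !card_supp_corner !step; lia.
Qed.

End RankProfile.

Theorem theorem3 (K : fieldType) (m n r : nat) (A : 'M[K]_(m, n))
    (rank_A : \rank A = r) :
  exists! RA : 'M[K]_(m, n),
    sub_permutation_mx r RA /\
    (forall (i j : nat) (le_im : (i <= m)%N) (le_jn : (j <= n)%N),
       (1 <= i)%N -> (1 <= j)%N ->
       \rank (leading_submx le_im le_jn RA) =
       \rank (leading_submx le_im le_jn A)).
Proof.
have rk0 := mxrank_rank_profile A.
have card0 := card_supp_rank_profile A.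
exists (rank_profile A); split.
  have rkr : #|supp (rank_profile A)| = r.
    by rewrite -[rank_profile A]corner_full card0 // rho_full.
  split; last first.
    move=> i j le_im le_jn _ _; rewrite !mxrank_leading.
    by rewrite mxrank_corner_full_supp // card0.
  split; [by rewrite rk0 | exact: rkr |].
  by move=> k l; rewrite rank_profile_neq0 mxE => ->.
move=> P [[rkP suppP P1] lead].
have cardP i j : (i <= m)%N -> (j <= n)%N -> #|supp (corner i j P)| = rho A i j.
  move=> le_im le_jn; rewrite -mxrank_corner_full_supp ?rkP ?suppP //.
  (* The hypothesis on [P] covers only nonempty blocks. Empty ones have rank 0 on both sides, and
     are needed for the differences in the first row and column. *)
  case: i le_im => [|i] le_im; first by rewrite -/(rho P 0 j) !rho0n.
  case: j le_jn => [|j] le_jn; first by rewrite -/(rho P i.+1 0) !rhon0.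
  by have := lead _ _ le_im le_jn isT isT; rewrite !mxrank_leading.
apply/matrixP=> k l.
have: rho_jump A k l = (P k l != 0).
  (* With equal counts, the two second-difference identities agree except in their last terms, which
     must then coincide. *)
  have := supp_count_jump P k l; have := rho_jumpE A k l.
  rewrite !cardP // ?(ltnW (ltn_ord _)) //.
  by move=> -> /addnI; case: rho_jump; case: (_ != _).
rewrite mxE => ->; have [->|/P1 ->] := eqVneq (P k l) 0; by [].
Qed.
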